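(* Consider the preconditioned stochastic gradient iteration $u^k=u^{k-1}+\mu_k(B+\gamma C)^{-1}(b^k-A_ku^{k-1})$, $k\ge 1$, under the assumptions listed in the context, with error $e^k=u^k-\hat u$. There exist $\gamma_0>0$ and $\hat\mu_0>0$ such that, if the sequence $(\mu_k)_{k\ge1}$ satisfies $0<\mu_k\le\hat\mu_0$ for all $k$, $\sum_{k=1}^\infty\mu_k=\infty$ and $\sum_{k=1}^\infty\mu_k^2<\infty$, then $$\lim_{k\to+\infty}E(e^ke^{kT})=0\quad\text{for all } 0\le\gamma\le\gamma_0 .$$
   Context: Setting. $X=X(t)$ is a stationary stochastic process with values in an interval of $\mathbb R$, each $X(t)$ having density $\rho$; $E(g(X))=\int g\rho\,dx$. $f$ is a deterministic function and $\phi_1,\dots,\phi_M$ are linearly independent basis functions on the sample space. Put $A=[a_{ij}]\in\mathbb R^{M\times M}$, $a_{ij}=E(\phi_i(X)\phi_j(X))$, and $b=[b_i]\in\mathbb R^M$, $b_i=E(\phi_i(X)f(X))$. These are finite and $A$ is symmetric positive definite. The theoretical best approximation $\hat u=\arg\min_{u\in\mathbb R^M}E\big((\sum_ju_j\phi_j(X)-f(X))^2\big)$ is the unique solution of $A\hat u=b$. Samples. For $k=1,2,\dots$, $N$ samples of $X$ are taken at times $t^k_1,\dots,t^k_N\in[t_1^k,t_N^k]$ with $t^k_N<t^{k+1}_1$, and $A_k=[a^k_{ij}]$, $a^k_{ij}=\frac1N\sum_{n=1}^N\phi_i(X(t^k_n))\phi_j(X(t^k_n))$, $b^k=[b^k_i]$,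 $b^k_i=\frac1N\sum_{n=1}^N\phi_i(X(t^k_n))f(X(t^k_n))$, so that $E(A_k)=A$, $E(b^k)=b$. Put $\theta^k=b^k-b$ and $\Omega_k=A_k-A$. Preconditioner. $B,C$ are fixed real $M\times M$ matrices (independent of $k$), $B$ symmetric positive definite, $C$ symmetric positive semidefinite, and $x^TB^{-1}Ax>0$ for all $x\in\mathbb R^M$ with $\|x\|=1$. For $\gamma\ge0$, $\Psi=(B+\gamma C)^{-1}$. Iteration. $u^0$ is a (possibly random) vector in $\mathbb R^M$ with finite second moments, not depending on $\gamma$ or on the step sizes; $\mu_k>0$ are deterministic step sizes; $u^k=u^{k-1}+\mu_k\Psi(b^k-A_ku^{k-1})$ for $k\ge1$; $e^k=u^k-\hat u$ for $k\ge 0$. $e^{kT}$ denotes the transpose of $e^k$. Assumptions on the random variables: 1. the $\theta^k$ are i.i.d. with $E(\theta^k)=0$; 2. the $\Omega_k$ are symmetric and i.i.d. with $E(\Omega_k)=0$; 3. the covariances $E(\theta^k\theta^{kT})$, $E(\mathrm{vec}(\Omega_k)\mathrm{vec}(\Omega_k)^T)$, $E(\mathrm{vec}(\Omega_k)\theta^{kT})$ exist (finite second moments) and do not depend on $k$, where $\mathrm{vec}$ stacks the columns of a matrix into one column vector; 4. for every $k\ge1$ (and for the iterates generated with any $\gamma\ge 0$ and any positive step sizes), $u^{k-1}$ and its products are pairwise independent of $\theta^k$ and $\Omega_k$ and their products: every entry of $u^{k-1}$ and every product of two entries of $u^{k-1}$ is independent of every entry of $\theta^k$ or $\Omega_k$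 and of every product of two such entries. The constants in the claim may depend on the data of the problem but not on $\gamma$, $k$ or the sequence $(\mu_k)$. *)

(* Defs.v *)
From HB Require Import structures.
From mathcomp Require Import all_boot all_order all_algebra.
From mathcomp Require Import all_classical all_reals all_analysis.
Import Order.TTheory GRing.Theory Num.Theory.
Import numFieldNormedType.Exports.

Set Implicit Arguments.
Unset Strict Implicit.
Unset Printing Implicit Defensive.

Local Open Scope classical_set_scope.
Local Open Scope ring_scope.

(* [mxvec] lists the entries row by row, hence the transpose: [vec A] stacks
   the columns of [A]. *)
Definition vec (R : Type) (m n : nat) (A : 'M[R]_(m, n)) : 'cV[R]_(n * m) :=
  (mxvec A^T)^T.

Definition symmetric_mx (R : nzRingType) (n : nat) (A : 'M[R]_n) : Prop :=
  A^T = A.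

Definition spd (R : realType) (n : nat) (A : 'M[R]_n) : Prop :=
  symmetric_mx A /\ forall x : 'cV[R]_n, x != 0 -> 0 < (x^T *m A *m x) 0 0.

Definition spsd (R : realType) (n : nat) (A : 'M[R]_n) : Prop :=
  symmetric_mx A /\ forall x : 'cV[R]_n, 0 <= (x^T *m A *m x) 0 0.

(* The Euclidean norm: the library's norm on matrices is the sup norm. *)
Definition enorm (R : realType) (n : nat) (x : 'cV[R]_n) : R :=
  Num.sqrt ((x^T *m x) 0 0).

Definition borel_mx (R : realType) (m n : nat) : set (set 'M[R]_(m, n)) :=
  <<s [set U : set 'M[R]_(m, n) | open U] >>.

(* Extended-real entries, so that an expectation which is not finite cannot be
   mistaken for a real number. *)
Definition mean_mx (d : measure_display) (T : measurableType d) (R : realType)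
    (P : probability T R) (m n : nat) (V : T -> 'M[R]_(m, n)) :
    'M[\bar R]_(m, n) :=
  \matrix_(i, j) ('E_P[fun w => V w i j])%E.

Definition square_integrable (d : measure_display) (T : measurableType d)
    (R : realType) (P : probability T R) (m n : nat)
    (V : T -> 'M[R]_(m, n)) : Prop :=
  forall i j, (fun w => V w i j) \in Lfun P 2%:E.

Definition same_law (d : measure_display) (T : measurableType d)
    (R : realType) (P : probability T R) (m n : nat)
    (V W : T -> 'M[R]_(m, n)) : Prop :=
  forall S, borel_mx S -> P (V @^-1` S) = P (W @^-1` S).

Definition mutually_independent (d : measure_display) (T : measurableType d)
    (R : realType) (P : probability T R) (m n : nat)
    (V : nat -> T -> 'M[R]_(m, n)) : Prop :=
  forall (J : seq nat) (S : nat -> set 'M[R]_(m, n)),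
    uniq J -> (forall k, borel_mx (S k)) ->
    P (\bigcap_(k in [set` J]) (V k @^-1` S k)) =
    (\prod_(k <- J) P (V k @^-1` S k))%E.

Definition iid (d : measure_display) (T : measurableType d) (R : realType)
    (P : probability T R) (m n : nat) (V : nat -> T -> 'M[R]_(m, n)) : Prop :=
  mutually_independent P V /\ forall k l, same_law P (V k) (V l).

Definition independent2 (d : measure_display) (T : measurableType d)
    (R : realType) (P : probability T R) (Y Z : T -> R) : Prop :=
  forall S1 S2 : set R, measurable S1 -> measurable S2 ->
    P (Y @^-1` S1 `&` Z @^-1` S2) = (P (Y @^-1` S1) * P (Z @^-1` S2))%E.

Definition entries (T : Type) (R : Type) (m n : nat)
    (V : T -> 'M[R]_(m, n)) : set (T -> R) :=
  [set Y | exists i j, Y = fun w => V w i j].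

Definition with_products (T : Type) (R : realType) (E : set (T -> R)) :
    set (T -> R) :=
  E `|` [set Y | exists Y1 Y2, [/\ E Y1, E Y2 & Y = fun w => Y1 w * Y2 w]].

(* [I] is the set of times of the process; [X s] is irrelevant for [s] outside
   [I]. *)
Definition stationary (d : measure_display) (T : measurableType d)
    (R : realType) (P : probability T R) (I : set R) (X : R -> T -> R) : Prop :=
  forall (n : nat) (s : 'I_n -> R) (h : R),
    (forall i, I (s i)) -> (forall i, I (s i + h)) ->
    same_law P (fun w => \col_i X (s i) w) (fun w => \col_i X (s i + h) w).

Definition has_density (d : measure_display) (T : measurableType d)
    (R : realType) (P : probability T R) (D : interval R) (rho : R -> R)
    (Y : T -> R) : Prop :=
  [/\ forall x, x \in D -> 0 <= rho x,
      measurable_fun [set` D] rho &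
      forall S : set R, measurable S ->
        P (Y @^-1` S) =
        (\int[lebesgue_measure]_(x in S `&` [set` D]) (rho x)%:E)%E].

(* [E (g (X))] for a random variable with density [rho] on [D]. *)
Definition density_mean (R : realType) (D : interval R) (rho g : R -> R) :
    \bar R :=
  (\int[lebesgue_measure]_(x in [set` D]) (g x * rho x)%:E)%E.

Definition density_integrable (R : realType) (D : interval R)
    (rho g : R -> R) : Prop :=
  lebesgue_measure.-integrable [set` D] (fun x => (g x * rho x)%:E).

Definition linearly_independent_on (R : realType) (D : interval R) (M : nat)
    (phi : 'I_M -> R -> R) : Prop :=
  forall c : 'I_M -> R,
    (forall x, x \in D -> \sum_i c i * phi i x = 0) -> forall i, c i = 0.

Definition exact_mx (R : realType) (D : interval R) (rho : R -> R) (M : nat)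
    (phi : 'I_M -> R -> R) : 'M[R]_M :=
  \matrix_(i, j) fine (density_mean D rho (fun x => phi i x * phi j x)).

Definition exact_rhs (R : realType) (D : interval R) (rho : R -> R) (M : nat)
    (phi : 'I_M -> R -> R) (f : R -> R) : 'cV[R]_M :=
  \col_i fine (density_mean D rho (fun x => phi i x * f x)).

Definition square_error (R : realType) (D : interval R) (rho : R -> R)
    (M : nat) (phi : 'I_M -> R -> R) (f : R -> R) (u : 'cV[R]_M) : \bar R :=
  density_mean D rho (fun x => (\sum_j u j 0 * phi j x - f x) ^+ 2).

(* Here and below the indices [k] of the blocks and [n] of the samples in a
   block start at 1. *)
Definition sample_mx (T : Type) (R : realType) (X : R -> T -> R) (M : nat)
    (phi : 'I_M -> R -> R) (N : nat) (t : nat -> nat -> R) (k : nat) (w : T) :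
    'M[R]_M :=
  \matrix_(i, j) (N%:R^-1 *
    \sum_(1 <= n < N.+1) phi i (X (t k n) w) * phi j (X (t k n) w)).

Definition sample_rhs (T : Type) (R : realType) (X : R -> T -> R) (M : nat)
    (phi : 'I_M -> R -> R) (f : R -> R) (N : nat) (t : nat -> nat -> R)
    (k : nat) (w : T) : 'cV[R]_M :=
  \col_i (N%:R^-1 *
    \sum_(1 <= n < N.+1) phi i (X (t k n) w) * f (X (t k n) w)).

Definition preconditioner (R : realType) (M : nat) (B C : 'M[R]_M)
    (gamma : R) : 'M[R]_M :=
  invmx (B + gamma *: C).

Fixpoint iterate (T : Type) (R : realType) (M : nat) (Psi : 'M[R]_M)
    (Ak : nat -> T -> 'M[R]_M) (bk : nat -> T -> 'cV[R]_M)
    (u0 : T -> 'cV[R]_M) (mu : nat -> R) (k : nat) (w : T) : 'cV[R]_M :=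
  if k is k'.+1 then
    let u := iterate Psi Ak bk u0 mu k' w in
    u + mu k *: (Psi *m (bk k w - Ak k w *m u))
  else u0 w.

(* Main.v *)
Require Import Defs.
From HB Require Import structures.
From mathcomp Require Import all_boot all_order all_algebra.
From mathcomp Require Import all_classical all_reals all_analysis.
From mathcomp Require Import measurable_realfun ring lra.
Import Order.TTheory GRing.Theory Num.Theory.
Import numFieldNormedType.Exports.

Set Implicit Arguments.
Unset Strict Implicit.
Unset Printing Implicit Defensive.

Local Open Scope classical_set_scope.
Local Open Scope ring_scope.

(* Weight the error with the inverse [Q = B + gamma C] of the preconditioner
   [Psi].  Since [A uhat = b], the error obeys
     e^k = e^{k-1} + mu_k Psi (xi^k - A e^{k-1}),  xi^k = theta^k - Omega_k u^{k-1},
   so that in [e^T Q e] the drift contributes [- 2 mu_k e^T A e], the cross terms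
   with [xi^k] have mean zero by independence, and the rest is of order
   [mu_k^2 (1 + E (e^T Q e))].  Hence [v_k = E (e^k^T Q e^k)] satisfies
     v_k <= (1 - a mu_k + b mu_k^2) v_{k-1} + c mu_k^2,
   which forces [v_k --> 0] by the Robbins-Monro argument. *)

(** * Fubini for a product of functions of separate variables *)

Section product_measure_product_function.
Local Open Scope ereal_scope.
Context d1 d2 (T1 : measurableType d1) (T2 : measurableType d2) (R : realType).
Variables (m1 : {sigma_finite_measure set T1 -> \bar R})
          (m2 : {sigma_finite_measure set T2 -> \bar R}).
Variables (f1 : T1 -> R) (f2 : T2 -> R).
Hypotheses (int1 : m1.-integrable setT (EFin \o f1))
           (int2 : m2.-integrable setT (EFin \o f2)).

Let mf1 : measurable_fun setT f1.
Proof. exact/measurable_EFinP/(measurable_int _ int1). Qed.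

Let mf2 : measurable_fun setT f2.
Proof. exact/measurable_EFinP/(measurable_int _ int2). Qed.

Let f (z : T1 * T2) : \bar R := (f1 z.1 * f2 z.2)%:E.

Lemma measurable_prod_fun : measurable_fun setT f.
Proof.
by apply/measurable_EFinP; apply: measurable_funM; exact: measurableT_comp.
Qed.

(** By Tonelli, the iterated integral of the absolute value factors into two finite integrals. *)
Lemma integrable_prod_fun : (m1 \x m2).-integrable setT f.
Proof.
apply/integrable12ltyP; first exact: measurable_prod_fun.
have E x : \int[m2]_y `|f (x, y)| = `|f1 x|%:E * \int[m2]_y `|f2 y|%:E.
  rewrite -ge0_integralZl//=.
  - by apply: eq_integral => y _; rewrite /f /= normrM EFinM.
  - by apply/measurable_EFinP; exact: measurableT_comp.
under eq_integral do rewrite E.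
rewrite ge0_integralZr//=.
- move: int1 int2 => /integrableP[_ lt1] /integrableP[_ lt2].
  by apply: lte_mul_pinfty => //; [exact: integral_ge0|
    rewrite ge0_fin_numE//; exact: integral_ge0].
- by apply/measurable_EFinP; exact: measurableT_comp.
- by apply: integral_ge0 => x _; rewrite lee_fin.
Qed.

Lemma integral_prod_fun :
  \int[m1 \x m2]_z f z = (\int[m1]_x (f1 x)%:E) * (\int[m2]_y (f2 y)%:E).
Proof.
rewrite -integral12_prod_meas1//=; last exact: integrable_prod_fun.
have E x : \int[m2]_y f (x, y) = (f1 x)%:E * \int[m2]_y (f2 y)%:E.
  by rewrite -integralZl.
under eq_integral do rewrite /fubini_F E.
have fin2 : \int[m2]_y (f2 y)%:E \is a fin_num by exact: integrable_fin_num.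
by rewrite -(fineK fin2) integralZr.
Qed.

End product_measure_product_function.

(** * Independence and means of products *)

Section independent_product.
Context d d1 d2 (T : measurableType d) (T1 : measurableType d1)
  (T2 : measurableType d2) (R : realType) (P : probability T R).
Variables (Y : {mfun T >-> T1}) (Z : {mfun T >-> T2}).
Hypothesis indepYZ : forall S1 S2, measurable S1 -> measurable S2 ->
  P (Y @^-1` S1 `&` Z @^-1` S2) = (P (Y @^-1` S1) * P (Z @^-1` S2))%E.
Variables (f1 : T1 -> R) (f2 : T2 -> R).
Hypotheses (mf1 : measurable_fun setT f1) (mf2 : measurable_fun setT f2)
  (int1 : P.-integrable setT (EFin \o (f1 \o Y)))
  (int2 : P.-integrable setT (EFin \o (f2 \o Z))).

Let mYZ : measurable_fun setT (fun w => (Y w, Z w)).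
Proof. exact: measurable_fun_pair. Qed.

Let YZ : {mfun T >-> (T1 * T2)%type} :=
  HB.pack (fun w => (Y w, Z w)) (isMeasurableFun.Build _ _ _ _ _ mYZ).

(** Independence says that the joint law and the product of the marginal laws agree on rectangles,
    and these values determine the product measure. *)
Let law_prod S : measurable S ->
  (distribution P Y \x distribution P Z)%E S = distribution P YZ S.
Proof. by apply: product_measure_unique => S1 S2 mS1 mS2; exact: indepYZ. Qed.

Let int1' : (distribution P Y).-integrable setT (EFin \o f1).
Proof. by apply: integrable_pushforward => //; exact/measurable_EFinP. Qed.

Let int2' : (distribution P Z).-integrable setT (EFin \o f2).
Proof. by apply: integrable_pushforward => //; exact/measurable_EFinP. Qed.

Let f (z : T1 * T2) : \bar R := (f1 z.1 * f2 z.2)%:E.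

Let mf : measurable_fun setT f.
Proof. exact: measurable_prod_fun int1' int2'. Qed.

(** The joint law being a product measure, integrability is transported from the product space to
    [T] along the pair of [Y] and [Z]. *)
Lemma integrable_indepM :
  P.-integrable setT (fun w => (f1 (Y w) * f2 (Z w))%:E).
Proof.
apply/integrableP; split; first exact: (measurableT_comp mf mYZ).
have /integrableP[_] := integrable_prod_fun int1' int2'; apply: le_lt_trans.
rewrite (@eq_measure_integral _ _ _ _ (distribution P YZ)); last first.
  by move=> S mS _; exact: law_prod.
rewrite ge0_integral_distribution//.
exact: (measurableT_comp _ mf).
Qed.

Lemma integral_indepM : (\int[P]_w (f1 (Y w) * f2 (Z w))%:E =
  (\int[P]_w (f1 (Y w))%:E) * (\int[P]_w (f2 (Z w))%:E))%E.
Proof.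
rewrite -[LHS](@integral_distribution _ _ _ _ _ P YZ f)//; last first.
  exact: integrable_indepM.
transitivity (\int[distribution P Y \x distribution P Z]_z f z)%E.
  by apply: eq_measure_integral => S mS _; exact/esym/law_prod.
rewrite integral_prod_fun// !(integral_distribution (f := EFin \o _))//.
  exact/measurable_EFinP.
exact/measurable_EFinP.
Qed.

End independent_product.

Section independent2_expectation.
Context d (T : measurableType d) (R : realType) (P : probability T R).
Variables Y Z : T -> R.
Hypotheses (L1Y : Y \in Lfun P 1) (L1Z : Z \in Lfun P 1).
Hypothesis indepYZ : independent2 P Y Z.

Let mY : measurable_fun setT Y.
Proof. by move: L1Y => /sub_Lfun_mfun; rewrite inE. Qed.

Let mZ : measurable_fun setT Z.
Proof. by move: L1Z => /sub_Lfun_mfun; rewrite inE. Qed.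

Let Y' : {mfun T >-> R} := HB.pack Y (isMeasurableFun.Build _ _ _ _ Y mY).
Let Z' : {mfun T >-> R} := HB.pack Z (isMeasurableFun.Build _ _ _ _ Z mZ).

Let int1 : P.-integrable setT (EFin \o (idfun \o Y')).
Proof. by have /Lfun1_integrable := L1Y. Qed.

Let int2 : P.-integrable setT (EFin \o (idfun \o Z')).
Proof. by have /Lfun1_integrable := L1Z. Qed.

Let mid : measurable_fun [set: R] idfun.
Proof. exact: measurable_id. Qed.

Lemma independent2_Lfun1M : (fun w => Y w * Z w) \in Lfun P 1.
Proof.
apply/Lfun1_integrable.
exact: (@integrable_indepM _ _ _ _ _ _ _ P Y' Z' indepYZ _ _ mid mid int1 int2).
Qed.

Lemma independent2_expectationM :
  ('E_P[fun w => (Y w * Z w)%R] = 'E_P[Y] * 'E_P[Z])%E.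
Proof.
rewrite unlock.
exact: (@integral_indepM _ _ _ _ _ _ _ P Y' Z' indepYZ _ _ mid mid int1 int2).
Qed.

End independent2_expectation.

(** * Inner products, quadratic forms and comparison constants *)

Section quadratic_forms.
Variables (R : realType) (n : nat).
Implicit Types (x y : 'cV[R]_n) (S : 'M[R]_n).

Definition dotmx x y : R := (x^T *m y) 0 0.
Definition qform S x : R := (x^T *m S *m x) 0 0.

Lemma dotmxE x y : dotmx x y = \sum_i x i 0 * y i 0.
Proof. by rewrite /dotmx mxE; apply: eq_bigr => i _; rewrite mxE. Qed.

Lemma dotmxC x y : dotmx x y = dotmx y x.
Proof. by rewrite !dotmxE; apply: eq_bigr => i _; rewrite mulrC. Qed.

Lemma dotmxDl x y z : dotmx (x + y) z = dotmx x z + dotmx y z.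
Proof. by rewrite /dotmx linearD mulmxDl mxE. Qed.

Lemma dotmxDr x y z : dotmx z (x + y) = dotmx z x + dotmx z y.
Proof. by rewrite dotmxC dotmxDl !(dotmxC z). Qed.

Lemma dotmxZl a x y : dotmx (a *: x) y = a * dotmx x y.
Proof. by rewrite /dotmx linearZ -scalemxAl mxE. Qed.

Lemma dotmxZr a x y : dotmx x (a *: y) = a * dotmx x y.
Proof. by rewrite dotmxC dotmxZl dotmxC. Qed.

Lemma dotmxNl x y : dotmx (- x) y = - dotmx x y.
Proof. by rewrite -scaleN1r dotmxZl mulN1r. Qed.

Lemma dotmxNr x y : dotmx x (- y) = - dotmx x y.
Proof. by rewrite -scaleN1r dotmxZr mulN1r. Qed.

Lemma dotmxx_ge0 x : 0 <= dotmx x x.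
Proof. by rewrite dotmxE sumr_ge0// => i _; rewrite -expr2 sqr_ge0. Qed.

Lemma sqr_entry_le x i : x i 0 ^+ 2 <= dotmx x x.
Proof.
rewrite dotmxE (bigD1 i)//= expr2 lerDl sumr_ge0// => j _.
by rewrite -expr2 sqr_ge0.
Qed.

Lemma dotmxx_sqrD x y : dotmx (x + y) (x + y) <= 2 * dotmx x x + 2 * dotmx y y.
Proof.
rewrite !dotmxE !mulr_sumr -big_split/=; apply: ler_sum => i _; rewrite mxE.
rewrite -subr_ge0.
rewrite (_ : _ - _ = (x i 0 - y i 0) ^+ 2); last by ring.
exact: sqr_ge0.
Qed.

Lemma qformE S x : qform S x = dotmx x (S *m x).
Proof. by rewrite /qform /dotmx mulmxA. Qed.

Lemma dotmx_sym S x y : symmetric_mx S -> dotmx x (S *m y) = dotmx (S *m x) y.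
Proof. by move=> Ssym; rewrite /dotmx trmx_mul Ssym mulmxA. Qed.

Lemma dotmx_mulmx S x y : dotmx (S *m x) y = dotmx x (S^T *m y).
Proof. by rewrite /dotmx trmx_mul mulmxA. Qed.

Lemma qform_le_dotmx S : exists2 c, 0 < c & forall x, qform S x <= c * dotmx x x.
Proof.
(* The summand 1 keeps the constant positive even for [S = 0]. *)
exists (1 + \sum_i \sum_j `|S i j|) => [|x].
  by rewrite ltr_pwDl// sumr_ge0// => i _; rewrite sumr_ge0.
rewrite mulrDl mul1r; apply: ler_wpDl; first exact: dotmxx_ge0.
rewrite qformE dotmxE mulr_suml ler_sum// => i _.
rewrite mxE mulr_sumr mulr_suml ler_sum// => j _.
apply: (le_trans (ler_norm _)).
rewrite mulrCA normrM ler_wpM2l// ler_norml.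
(* The squares of [x_i + x_j] and [x_i - x_j] are nonnegative, so [2 |x_i x_j| <= x_i^2 + x_j^2],
   which is at most twice [dotmx x x]. *)
have := sqr_entry_le x i; have := sqr_entry_le x j.
have := sqr_ge0 (x i 0 + x j 0); have := sqr_ge0 (x i 0 - x j 0).
move: (x i 0) (x j 0) (dotmx x x) => a b c h1 h2 h3 h4.
by apply/andP; split; nra.
Qed.

(** A nonzero kernel vector would make the quadratic form vanish. The transposes appear because
    [kermx] is a left kernel. *)
Lemma spd_unitmx S : spd S -> S \in unitmx.
Proof.
move=> [Ssym Spos]; rewrite -unitmx_tr -row_free_unit -kermx_eq0.
apply/eqP/row_matrixP => i; rewrite row0; apply/eqP.
rewrite -[row i _]trmxK trmx_eq0; apply/negPn/negP => /Spos; rewrite -mulmxA.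
suff -> : S *m (row i (kermx S^T))^T = 0 by rewrite mulmx0 mxE ltxx.
by apply: trmx_inj; rewrite trmx_mul trmxK -row_mul mulmx_ker row0 trmx0.
Qed.

Lemma spd_qform_ge0 S x : spd S -> 0 <= qform S x.
Proof.
move=> [_ Spos]; have [->|/Spos/ltW//] := eqVneq x 0.
by rewrite /qform mulmx0 mxE.
Qed.

Lemma spd_cauchy_schwarz S x y : spd S ->
  dotmx y (S *m x) ^+ 2 <= qform S y * qform S x.
Proof.
move=> Sspd; have Ssym := Sspd.1.
have [->|y0] := eqVneq y 0.
  by rewrite /qform mulmx0 /dotmx trmx0 mul0mx mxE expr2 !mul0r.
have qy : 0 < qform S y by exact: (Sspd.2 y y0).
(* This vector is [qform S y] times the component of [x] that is [S]-orthogonal to [y]; its form is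
   [qform S y] times the difference of the two sides of the claim. *)
have := @spd_qform_ge0 S (qform S y *: x + - dotmx y (S *m x) *: y) Sspd.
rewrite [X in 0 <= X]qformE mulmxDr -!scalemxAr !(dotmxDl, dotmxDr, dotmxZl, dotmxZr).
rewrite -!qformE [dotmx x (S *m y)]dotmx_sym// [dotmx (S *m x) y]dotmxC.
rewrite [X in 0 <= X](_ : _ = qform S y * (qform S y * qform S x - dotmx y (S *m x) ^+ 2)).
  by rewrite pmulr_rge0// subr_ge0.
ring.
Qed.

(* [x_i] is the [S]-inner product of [x] with [S^-1 e_i]. *)
Lemma spd_dotmx_le S : spd S -> exists2 c, 0 < c & forall x, dotmx x x <= c * qform S x.
Proof.
move=> Sspd; have Su := spd_unitmx Sspd.
pose y i : 'cV[R]_n := invmx S *m delta_mx i 0.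
exists (1 + \sum_i qform S (y i)) => [|x].
  by rewrite ltr_pwDl// sumr_ge0// => i _; exact: spd_qform_ge0.
rewrite mulrDl mul1r; apply: ler_wpDl; first exact: spd_qform_ge0.
rewrite dotmxE mulr_suml ler_sum// => i _.
have -> : x i 0 = dotmx (y i) (S *m x).
  rewrite dotmx_sym; last exact: Sspd.1.
  rewrite /y mulmxA mulmxV// mul1mx dotmxE (bigD1 i)//= !mxE !eqxx mul1r big1 ?addr0//.
  by move=> j ji; rewrite mxE (negbTE ji) mul0r.
by rewrite -expr2 spd_cauchy_schwarz.
Qed.

(** Weighting with the inverse of the preconditioner cancels [P] in the first-order term, which is
    why the error is measured in this form. *)
Lemma qform_precond_step S P x y mu : symmetric_mx S -> S *m P = 1%:M ->
  qform S (x + mu *: (P *m y)) =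
  qform S x + mu * (2 * dotmx x y) + mu ^+ 2 * dotmx y (P *m y).
Proof.
move=> Ssym SP.
rewrite [LHS]qformE mulmxDr -scalemxAr mulmxA SP mul1mx.
rewrite !(dotmxDl, dotmxDr, dotmxZl, dotmxZr) -qformE.
rewrite [dotmx (P *m y) (S *m x)]dotmx_sym// mulmxA SP mul1mx.
rewrite [dotmx y x]dotmxC [dotmx (P *m y) y]dotmxC.
ring.
Qed.

End quadratic_forms.

(** * The scalar Robbins-Monro recursion *)

(** Far enough out, half of the drift absorbs the term in [b], and the remaining noise [c * mu^2]
    sums to at most [eps / 2]. Divergence of the sum of [mu] brings [v] down to [eps / 2] at some
    time, after which the noise cannot lift it above [eps]. *)
Lemma robbins_monro_cvg (R : realType) (v mu : nat -> R) (a b c : R) :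
  0 < a -> 0 <= b -> 0 <= c -> (forall k, 0 <= v k) ->
  (forall k, 0 < mu k.+1) ->
  (forall k, v k.+1 <= (1 - a * mu k.+1 + b * mu k.+1 ^+ 2) * v k
                       + c * mu k.+1 ^+ 2) ->
  (forall B K, exists n, B < \sum_(K <= j < n) mu j.+1) ->
  (forall eps, 0 < eps -> exists K, forall n, \sum_(K <= j < n) mu j.+1 ^+ 2 < eps) ->
  forall eps, 0 < eps -> exists K, forall n, (K <= n)%N -> v n <= eps.
Proof.
move=> a0 b0 c0 v0 mu0 step div sq eps eps0.
(* A tail of the sum of squares bounds each of its terms, so [mu j.+1 < a / (2 (b + 1))] eventually.
   Dividing by [b + 1] rather than [b] allows [b = 0]; [c + 1] below serves the same purpose. *)
have [K1 HK1] : exists K, forall j, (K <= j)%N -> b * mu j.+1 <= a / 2.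
  have [K HK] := sq ((a / 2 / (b + 1)) ^+ 2) ltac:(apply: exprn_gt0; apply: divr_gt0; lra).
  exists K => j Kj; have := HK j.+1.
  rewrite big_nat_recr//= => h.
  have : mu j.+1 ^+ 2 < (a / 2 / (b + 1)) ^+ 2.
    apply: le_lt_trans h; rewrite lerDr sumr_ge0// => i _; exact: sqr_ge0.
  rewrite ltr_pXn2r// ?nnegrE; [|exact: ltW|apply: divr_ge0; lra].
  rewrite ltr_pdivlMr; last lra.
  by have := mu0 j; nra.
have [K2 HK2] := sq (eps / 2 / (c + 1)) ltac:(apply: divr_gt0; lra).
pose K := maxn K1 K2.
have HK n : (K <= n)%N -> forall m, (K <= m)%N -> c * \sum_(m <= j < n) mu j.+1 ^+ 2 <= eps / 2.
  move=> Kn m Km.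
  have [nm|/ltnW mn] := leqP n m.
    by rewrite big_geq// mulr0; lra.
  have h := HK2 n.
  have : \sum_(m <= j < n) mu j.+1 ^+ 2 <= \sum_(K2 <= j < n) mu j.+1 ^+ 2.
    rewrite [leRHS](@big_cat_nat _ _ _ m)//=; last exact: leq_trans (leq_maxr _ _) Km.
    by rewrite lerDr sumr_ge0// => i _; exact: sqr_ge0.
  have S0 : 0 <= \sum_(m <= j < n) mu j.+1 ^+ 2 by rewrite sumr_ge0// => i _; exact: sqr_ge0.
  move=> h2; have : \sum_(m <= j < n) mu j.+1 ^+ 2 < eps / 2 / (c + 1)
    by exact: le_lt_trans h.
  rewrite ltr_pdivlMr; last lra.
  nra.
(* The second-order term is at most half of the drift, by the choice of [K1]. *)
have step' j : (K <= j)%N -> v j.+1 <= v j - a / 2 * (mu j.+1 * v j) + c * mu j.+1 ^+ 2.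
  move=> Kj; apply: (le_trans (step j)).
  have := HK1 j (leq_trans (leq_maxl _ _) Kj).
  have := mu0 j; have := v0 j => h1 h2 h3.
  have : b * mu j.+1 * (mu j.+1 * v j) <= a / 2 * (mu j.+1 * v j).
    by rewrite ler_wpM2r// mulr_ge0// ltW.
  rewrite expr2; nra.
have sum_step m d : (K <= m)%N ->
    v (m + d)%N <= v m - a / 2 * \sum_(m <= j < m + d) mu j.+1 * v j
       + c * \sum_(m <= j < m + d) mu j.+1 ^+ 2.
  move=> Km; elim: d => [|d IH].
    by rewrite addn0 !big_geq// !mulr0 subr0 addr0.
  rewrite addnS !big_nat_recr ?leq_addr//= !mulrDr.
  have := step' (m + d)%N (leq_trans Km (leq_addr _ _)).
  lra.
(* Otherwise the sum of the [mu_j v_j] diverges and drives [v] below zero. *)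
have [m Km vm] : exists2 m, (K <= m)%N & v m <= eps / 2.
  apply: contrapT => /forall2NP H.
  have Hv m : (K <= m)%N -> eps / 2 < v m.
    by move=> Km; have [//|/negP] := H m; rewrite -ltNge.
  (* With [v > eps / 2] throughout, the accumulated drift is at least [a * eps / 4] times the sum of
     [mu]. This threshold makes it exceed [v K + eps], whereas the noise returns at most
     [eps / 2]. *)
  have [n Hn] := div (4 / (a * eps) * (v K + eps)) K.
  have [nK|/ltnW Kn] := leqP n K.
    move: Hn; rewrite big_geq// ltNge => /negP; apply.
    by rewrite mulr_ge0 ?divr_ge0 ?addr_ge0 ?mulr_ge0 ?v0// ltW.
  have := sum_step K (n - K)%N (leqnn _); rewrite subnKC// => h.
  have h1 := HK n Kn K (leqnn _).
  have h2 : eps / 2 * \sum_(K <= j < n) mu j.+1 <= \sum_(K <= j < n) mu j.+1 * v j.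
    rewrite mulr_sumr big_nat_cond [leRHS]big_nat_cond ler_sum// => j /andP[/andP[Kj _] _].
    by rewrite mulrC ler_pM2l// ltW// Hv.
  have h3 : v K + eps < a * eps / 4 * \sum_(K <= j < n) mu j.+1.
    move: Hn; rewrite mulrC -ltr_pdivlMr ?divr_gt0 ?mulr_gt0//.
    by rewrite invf_div [_ / _ * _]mulrC mulrC.
  have := v0 n; nra.
exists m => n mn.
have := sum_step m (n - m)%N Km; rewrite subnKC// => h.
have h1 := HK n (leq_trans Km mn) m Km.
have : 0 <= a / 2 * \sum_(m <= j < n) mu j.+1 * v j.
  rewrite mulr_ge0//; first lra.
  by rewrite sumr_ge0// => i _; rewrite mulr_ge0// ltW.
lra.
Qed.

(** * Finite means and square-integrable functions *)

Section has_mean.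
Context d (T : measurableType d) (R : realType) (P : probability T R).
Implicit Types Y Z : T -> R.

(** Integrability is bundled with a real value, so that means can be added, scaled and compared in
    [R] without separate finiteness conditions. *)
Definition has_mean Y (m : R) := Y \in Lfun P 1 /\ 'E_P[Y]%E = m%:E.

Lemma has_mean_Lfun1 Y : Y \in Lfun P 1 -> exists m, has_mean Y m.
Proof.
by move=> L1Y; exists (fine 'E_P[Y])%E; split; rewrite ?fineK ?expectation_fin_num.
Qed.

Lemma has_meanD Y Z m m' : has_mean Y m -> has_mean Z m' ->
  has_mean (fun w => Y w + Z w) (m + m').
Proof.
move=> [L1Y EY] [L1Z EZ]; split; first exact: rpredD.
by rewrite (expectationD L1Y L1Z) EY EZ.
Qed.

Lemma has_meanZ a Y m : has_mean Y m -> has_mean (fun w => a * Y w) (a * m).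
Proof.
move=> [L1Y EY]; have -> : (fun w => a * Y w) = a \o* Y.
  by apply/funext => w /=; rewrite mulrC.
by split; [exact: Lfun_scale | rewrite expectationZl// EY].
Qed.

Lemma has_mean_cst a : has_mean (fun=> a) a.
Proof. by split; [exact: Lfun_cst | rewrite expectation_cst]. Qed.

Lemma has_mean_sum (I : finType) (Y : I -> T -> R) (m : I -> R) :
  (forall i, has_mean (Y i) (m i)) ->
  has_mean (fun w => \sum_i Y i w) (\sum_i m i).
Proof.
move=> Ym.
suff /(_ (index_enum I)) : forall s, has_mean (fun w => \sum_(i <- s) Y i w) (\sum_(i <- s) m i) by [].
elim=> [|i s IH].
  rewrite big_nil; have -> : (fun w => \sum_(i <- [::]) Y i w) = fun=> 0.
    by apply/funext => w; rewrite big_nil.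
  exact: has_mean_cst.
rewrite big_cons; have -> : (fun w => \sum_(i <- i :: s) Y i w) =
    fun w => Y i w + \sum_(i <- s) Y i w.
  by apply/funext => w; rewrite big_cons.
exact: has_meanD.
Qed.

Lemma has_mean_le Y Z m m' : has_mean Y m -> has_mean Z m' ->
  (forall w, Y w <= Z w) -> m <= m'.
Proof.
move=> Ym Zm' YZ; rewrite -subr_ge0 -lee_fin -mulN1r addrC -(has_meanD (has_meanZ (-1) Ym) Zm').2.
by apply: expectation_ge0 => w; rewrite mulN1r addrC subr_ge0.
Qed.

Lemma has_mean_indepM Y Z m m' : independent2 P Y Z ->
  has_mean Y m -> has_mean Z m' -> has_mean (fun w => Y w * Z w) (m * m').
Proof.
move=> YZ [L1Y EY] [L1Z EZ]; split; first exact: independent2_Lfun1M.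
by rewrite independent2_expectationM// EY EZ.
Qed.

Lemma Lfun2_sqr Y : measurable_fun setT Y ->
  (fun w => Y w * Y w) \in Lfun P 1 -> Y \in Lfun P 2%:E.
Proof.
move=> mY /Lfun1_integrable /integrableP[_ fin].
rewrite inE; apply/andP; split; rewrite inE//= /finite_norm unlock /Lnorm.
rewrite poweR_lty//; apply: le_lt_trans fin.
apply: ge0_le_integral => //=.
- apply/measurable_EFinP.
  by apply: (@measurableT_comp _ _ _ _ _ _ (@powR R ^~ 2)) => //; exact: measurableT_comp.
- by apply/measurable_EFinP; apply: measurableT_comp => //; exact: measurable_funM.
- by move=> w _; rewrite lee_fin powR_mulrn// normrM expr2.
Qed.

Lemma Lfun2_measurable Y : Y \in Lfun P 2%:E -> measurable_fun setT Y.
Proof. by move=> /sub_Lfun_mfun; rewrite inE. Qed.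

Lemma Lfun2_Lfun1 Y : Y \in Lfun P 2%:E -> Y \in Lfun P 1.
Proof. by apply: Lfun_subset12; rewrite fin_num_measure. Qed.

(** Square integrability of both factors alone makes the product merely integrable. Independence of
    the squares makes [Y^2 Z^2] integrable as well. *)
Lemma Lfun2_indepM Y Z : Y \in Lfun P 2%:E -> Z \in Lfun P 2%:E ->
  independent2 P (fun w => Y w * Y w) (fun w => Z w * Z w) ->
  (fun w => Y w * Z w) \in Lfun P 2%:E.
Proof.
move=> L2Y L2Z YZ; apply: Lfun2_sqr.
  by apply: measurable_funM; exact: Lfun2_measurable.
rewrite (_ : (fun w => _) = fun w => (Y w * Y w) * (Z w * Z w)); last first.
  by apply/funext => w; rewrite mulrACA.
by apply: independent2_Lfun1M => //; exact: Lfun2_mul_Lfun1.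
Qed.

Lemma Lfun2_sum (I : finType) (Y : I -> T -> R) :
  (forall i, Y i \in Lfun P 2%:E) -> (fun w => \sum_i Y i w) \in Lfun P 2%:E.
Proof.
move=> L2Y; rewrite (_ : (fun w => _) = \sum_i Y i); last first.
  by apply/funext => w; rewrite fct_sumE.
by apply: rpred_sum => //; rewrite lee1n.
Qed.

Lemma Lfun2D Y Z : Y \in Lfun P 2%:E -> Z \in Lfun P 2%:E ->
  (fun w => Y w + Z w) \in Lfun P 2%:E.
Proof. by move=> L2Y L2Z; apply: rpredD => //; rewrite lee1n. Qed.

Lemma Lfun2Z a Y : Y \in Lfun P 2%:E -> (fun w => a * Y w) \in Lfun P 2%:E.
Proof.
move=> L2Y; rewrite (_ : (fun w => _) = a \o* Y); last first.
  by apply/funext => w /=; rewrite mulrC.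
by apply: Lfun_scale => //; rewrite ler1n.
Qed.

End has_mean.

(** * Square-integrable random matrices *)

Section square_integrable.
Context d (T : measurableType d) (R : realType) (P : probability T R).

Lemma square_integrableD m n (V W : T -> 'M[R]_(m, n)) :
  square_integrable P V -> square_integrable P W ->
  square_integrable P (fun w => V w + W w).
Proof.
move=> L2V L2W i j; rewrite (_ : (fun w => _) = fun w => V w i j + W w i j).
  exact: Lfun2D.
by apply/funext => w; rewrite mxE.
Qed.

Lemma square_integrableZ m n a (V : T -> 'M[R]_(m, n)) :
  square_integrable P V -> square_integrable P (fun w => a *: V w).
Proof.
move=> L2V i j; rewrite (_ : (fun w => _) = fun w => a * V w i j).
  exact: Lfun2Z.
by apply/funext => w; rewrite mxE.
Qed.

Lemma square_integrableN m n (V : T -> 'M[R]_(m, n)) :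
  square_integrable P V -> square_integrable P (fun w => - V w).
Proof.
move=> L2V; rewrite (_ : (fun w => _) = fun w => -1 *: V w).
  exact: square_integrableZ.
by apply/funext => w; rewrite scaleN1r.
Qed.

Lemma square_integrable_cst m n (S : 'M[R]_(m, n)) :
  square_integrable P (fun=> S).
Proof. by move=> i j; exact: Lfun_cst. Qed.

Lemma square_integrable_mull m n p (S : 'M[R]_(m, n)) (V : T -> 'M[R]_(n, p)) :
  square_integrable P V -> square_integrable P (fun w => S *m V w).
Proof.
move=> L2V i j; rewrite (_ : (fun w => _) = fun w => \sum_k S i k * V w k j).
  by apply: Lfun2_sum => k; exact: Lfun2Z.
by apply/funext => w; rewrite mxE.
Qed.

Lemma has_mean_qform n (S : 'M[R]_n) (x : T -> 'cV[R]_n) :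
  square_integrable P x -> exists m, has_mean P (fun w => qform S (x w)) m.
Proof.
move=> L2x.
have /choice[m Hm] : forall ij : 'I_n * 'I_n,
    exists m, has_mean P (fun w => x w ij.1 0 * x w ij.2 0) m.
  by move=> ij; apply/has_mean_Lfun1/Lfun2_mul_Lfun1.
exists (\sum_i \sum_j S i j * m (i, j)).
rewrite (_ : (fun w => _) =
    fun w => \sum_i \sum_j S i j * (x w i 0 * x w j 0)); last first.
  apply/funext => w; rewrite qformE dotmxE; apply: eq_bigr => i _.
  by rewrite mxE mulr_sumr; apply: eq_bigr => j _; rewrite mulrCA.
apply: has_mean_sum => i; apply: has_mean_sum => j; apply: has_meanZ.
exact: (Hm (i, j)).
Qed.

End square_integrable.

(** Cauchy-Schwarz against the constant vector, by summing [2 x_i x_j <= x_i^2 + x_j^2] over all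
    pairs. *)
Lemma sqr_sum_le (R : realType) n (x : 'I_n -> R) :
  (\sum_i x i) ^+ 2 <= n%:R * \sum_i x i ^+ 2.
Proof.
rewrite -(@ler_pM2l _ 2)// expr2 mulr_suml.
have -> : n%:R * \sum_i x i ^+ 2 = \sum_(i < n) \sum_(j < n) x j ^+ 2.
  by rewrite sumr_const card_ord mulr_natl.
rewrite [leRHS]mulrDl mul1r {1}exchange_big/= -big_split/= mulr_sumr.
apply: ler_sum => i _; rewrite mulr_sumr mulr_sumr -big_split/=.
apply: ler_sum => j _.
by have := sqr_ge0 (x i - x j); nra.
Qed.

(** * One step of the error recursion, pointwise and in mean *)

Section error_step.
Context d (T : measurableType d) (R : realType) (P : probability T R) (M : nat).
Variables (A Q Psi : 'M[R]_M) (uhat : 'cV[R]_M).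
Variables (St : 'I_M -> R) (SO : 'I_M -> 'I_M -> R).
Hypotheses (Aspd : spd A) (Qspd : spd Q) (QPsi : Q *m Psi = 1%:M).

(** The step splits into the drift from [g] to [g - mu *: (Psi *m (A *m g))] and the noise
    [mu *: (Psi *m xi)], and [qform_precond_step] applies to each. In the noise bound, squares of
    entries of [u] and of [Omega] are separate factors, so that independence can factor its mean. *)
Lemma qform_error_step : exists a b c : R, [/\ 0 < a, 0 <= b, 0 <= c &
  forall (u theta : 'cV[R]_M) (Omega : 'M[R]_M) (mu : R), 0 <= mu ->
    forall g xi, g = u - uhat -> xi = theta - Omega *m u ->
    qform Q (g + mu *: (Psi *m (xi - A *m g))) <=
    (1 - a * mu + b * mu ^+ 2) * qform Q g +
    (2 * mu) * dotmx (g - mu *: (Psi *m (A *m g))) xi +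
    c * mu ^+ 2 * (\sum_i theta i 0 * theta i 0 +
      \sum_i \sum_j (u j 0 * u j 0) * (Omega i j * Omega i j))].
Proof.
have [kA kA0 HA] := spd_dotmx_le Aspd.
have [kQ kQ0 HQ] := spd_dotmx_le Qspd.
have [lQ lQ0 HlQ] := qform_le_dotmx Q.
have [lP lP0 HlP] := qform_le_dotmx Psi.
have [lA lA0 HlA] := qform_le_dotmx (A^T *m Psi *m A).
(* The first two constants compare the forms of [A] and of [A^T Psi A] with that of [Q] through the
   Euclidean norm. In the third, [lP] bounds the form of [Psi], 2 comes from splitting [xi] into two
   summands, and [M] from squaring a sum of [M] terms in [Omega *m u]. *)
exists (2 / (kA * lQ)), (lA * kQ), (2 * lP * (1 + M%:R)); split.
- by rewrite divr_gt0 ?mulr_gt0.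
- by rewrite ltW ?mulr_gt0.
- by rewrite mulr_ge0 ?addr_ge0// mulr_ge0// ltW.
move=> u theta Omega mu mu0 g xi _ xiE.
have Qsym := Qspd.1.
rewrite mulmxBr scalerBr addrCA [X in qform Q X]addrC.
rewrite qform_precond_step// -scalerN -mulmxN qform_precond_step//.
have -> : dotmx g (- (A *m g)) = - qform A g.
  by rewrite dotmxNr qformE.
have -> : dotmx (- (A *m g)) (Psi *m - (A *m g)) = qform (A^T *m Psi *m A) g.
  by rewrite mulmxN dotmxNl dotmxNr opprK qformE dotmx_mulmx !mulmxA.
have H1 : qform Q g <= kA * lQ * qform A g.
  apply: (le_trans (HlQ g)); rewrite [kA * lQ]mulrC -mulrA.
  by rewrite ler_wpM2l// ltW.
have H1' : 2 / (kA * lQ) * qform Q g <= 2 * qform A g.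
  by rewrite -mulrA ler_pM2l// mulrC ler_pdivrMr ?mulr_gt0// mulrC.
have H2 : qform (A^T *m Psi *m A) g <= lA * kQ * qform Q g.
  by apply: (le_trans (HlA g)); rewrite -mulrA ler_wpM2l// ltW.
have H3 : dotmx xi (Psi *m xi) <= 2 * lP * (1 + M%:R) *
    (\sum_i theta i 0 * theta i 0 +
      \sum_i \sum_j (u j 0 * u j 0) * (Omega i j * Omega i j)).
  rewrite -qformE; apply: (le_trans (HlP xi)).
  rewrite [2 * lP]mulrC -!mulrA ler_wpM2l//; first exact: ltW.
  rewrite xiE; apply: (le_trans (dotmxx_sqrD _ _)).
  rewrite -mulrDr ler_pM2l// mulrDr.
  have s0 : 0 <= \sum_i theta i 0 * theta i 0.
    by apply: sumr_ge0 => i _; rewrite -expr2 sqr_ge0.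
  apply: lerD.
    by rewrite dotmxE mulrDl mul1r lerDl mulr_ge0.
  rewrite dotmxNl dotmxNr opprK.
  rewrite mulrDl mul1r; apply: ler_wpDl.
    by apply: sumr_ge0 => i _; apply: sumr_ge0 => j _; rewrite -!expr2 mulr_ge0 ?sqr_ge0.
  rewrite dotmxE mulr_sumr; apply: ler_sum => i _.
  rewrite -expr2 mxE; apply: (le_trans (sqr_sum_le _)).
  rewrite ler_wpM2l//; apply: ler_sum => j _.
  by rewrite exprMn !expr2 mulrC.
rewrite mulmxN scalerN.
move: H1' H2 H3; set N2 := \sum_i _ + _; set X := dotmx (g - _) xi.
set a := 2 / _; set b := lA * kQ; set c := 2 * lP * _ => H1' H2 H3.
have := ler_wpM2l mu0 H1'; have := ler_wpM2l (sqr_ge0 mu) H2; have := ler_wpM2l (sqr_ge0 mu) H3.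
lra.
Qed.

(** [St] and [SO] are the second moments of the noise entries. As they are fixed before the
    constants, the same [a], [b], [c] serve every step of the iteration. *)
Lemma mean_error_step : exists a b c : R, [/\ 0 < a, 0 <= b, 0 <= c &
  forall (u theta : T -> 'cV[R]_M) (Omega : T -> 'M[R]_M) (mu : R), 0 <= mu ->
    square_integrable P u -> square_integrable P theta ->
    square_integrable P Omega ->
    (forall i, has_mean P (fun w => theta w i 0) 0) ->
    (forall i j, has_mean P (fun w => Omega w i j) 0) ->
    (forall i, has_mean P (fun w => theta w i 0 * theta w i 0) (St i)) ->
    (forall i j, has_mean P (fun w => Omega w i j * Omega w i j) (SO i j)) ->
    (forall Y Z : T -> R, with_products (entries u) Y ->
       with_products (entries theta `|` entries Omega) Z -> independent2 P Y Z) ->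
    let e w := u w - uhat in
    let e' w := e w + mu *: (Psi *m ((theta w - Omega w *m u w) - A *m e w)) in
    square_integrable P e' /\
    forall v v', has_mean P (fun w => qform Q (e w)) v ->
      has_mean P (fun w => qform Q (e' w)) v' ->
      v' <= (1 - a * mu + b * mu ^+ 2) * v + c * mu ^+ 2].
Proof.
have [a [b [c [a0 b0 c0 step]]]] := qform_error_step.
have [kQ kQ0 HQ] := spd_dotmx_le Qspd.
pose sO := \sum_i \sum_j `|SO i j|.
have sO0 : 0 <= sO by apply: sumr_ge0 => i _; exact: sumr_ge0.
have uu0 := dotmxx_ge0 uhat.
(* The noise involves the mean of [|u|^2], at most [2 * kQ * v + 2 * |uhat|^2] because
   [u = e + uhat]. The part in [v] enlarges [b], the rest goes into [c]. Absolute values make both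
   constants visibly nonnegative. *)
exists a, (b + c * sO * (2 * kQ)), (c * (\sum_i `|St i| + sO * (2 * dotmx uhat uhat))).
split=> //.
- by rewrite addr_ge0// !mulr_ge0// ltW.
- by rewrite mulr_ge0// addr_ge0 ?sumr_ge0// !mulr_ge0.
move=> u theta Omega mu mu0 L2u L2t L2O mt mO st sO' ind e e'.
have uE i : entries u (fun w => u w i 0) by exists i, 0.
have tE i : (entries theta `|` entries Omega) (fun w => theta w i 0) by left; exists i, 0.
have OE i j : (entries theta `|` entries Omega) (fun w => Omega w i j) by right; exists i, j.
have L2e : square_integrable P e.
  by apply: square_integrableD => //; exact: square_integrable_cst.
(* Independence is needed here for squares of entries, hence the [right] case of [with_products] on
   both sides. *)
have L2Ou : square_integrable P (fun w => Omega w *m u w).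
  move=> i j; rewrite (_ : (fun w => _) = fun w => \sum_k u w k 0 * Omega w i k).
    apply: Lfun2_sum => k; apply: Lfun2_indepM => //.
    apply: ind; right; [exists (fun w => u w k 0), (fun w => u w k 0)|
      exists (fun w => Omega w i k), (fun w => Omega w i k)]; by split.
  by apply/funext => w; rewrite mxE (ord1 j); apply: eq_bigr => k _; rewrite mulrC.
have L2e' : square_integrable P e'.
  apply: square_integrableD => //; apply: square_integrableZ.
  apply: square_integrable_mull.
  apply: square_integrableD.
    by apply: square_integrableD => //; exact: square_integrableN.
  exact/square_integrableN/square_integrable_mull.
split=> // v v' ev ev'.
have /choice[mu1 Hmu1] : forall i, exists m, has_mean P (fun w => u w i 0) m.
  by move=> i; apply/has_mean_Lfun1/Lfun2_Lfun1.
have /choice[mu2 Hmu2] : forall ij : 'I_M * 'I_M, exists m,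
    has_mean P (fun w => u w ij.1 0 * u w ij.2 0) m.
  by move=> ij; apply/has_mean_Lfun1/Lfun2_mul_Lfun1.
have add0 Y Z : has_mean P Y 0 -> has_mean P Z 0 ->
    has_mean P (fun w => Y w + Z w) 0.
  by move=> Y0 scl0; rewrite -[0]addr0; exact: has_meanD.
have scl0 k Y : has_mean P Y 0 -> has_mean P (fun w => k * Y w) 0.
  by move=> Y0; rewrite -(mulr0 k); exact: has_meanZ.
have sum0 (Y : 'I_M -> T -> R) : (forall i, has_mean P (Y i) 0) ->
    has_mean P (fun w => \sum_i Y i w) 0.
  by move=> Y0; have := has_mean_sum Y0; rewrite big1.
have ut l i : has_mean P (fun w => u w l 0 * theta w i 0) 0.
  rewrite -(mulr0 (mu1 l)); apply: has_mean_indepM => //.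
  by apply: ind; left.
have uO j k i : has_mean P (fun w => u w j 0 * Omega w k i) 0.
  rewrite -(mulr0 (mu1 j)); apply: has_mean_indepM => //.
  by apply: ind; left.
have uuO l j k i : has_mean P (fun w => (u w l 0 * u w j 0) * Omega w k i) 0.
  rewrite -(mulr0 (mu2 (l, j))); apply: has_mean_indepM (Hmu2 (l, j)) _ => //.
  apply: ind; [right|by left].
  by exists (fun w => u w l 0), (fun w => u w j 0).
have uuOO i j : has_mean P
    (fun w => (u w j 0 * u w j 0) * (Omega w i j * Omega w i j)) (mu2 (j, j) * SO i j).
  apply: has_mean_indepM (Hmu2 (j, j)) _ => //.
  apply: ind; right.
    by exists (fun w => u w j 0), (fun w => u w j 0).
  by exists (fun w => Omega w i j), (fun w => Omega w i j).
have cross : has_mean P (fun w => dotmx (e w - mu *: (Psi *m (A *m e w)))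
   (theta w - Omega w *m u w)) 0.
  (* The first factor is [H *m e]. The inner product becomes a combination of single entries of
     [theta] or [Omega], each times a monomial of degree at most 2 in [u], and all these terms have
     mean zero. *)
  pose H := 1%:M - mu *: (Psi *m A).
  rewrite (_ : (fun w => _) = fun w => \sum_i \sum_l H i l *
    ((u w l 0 * theta w i 0 + - uhat l 0 * theta w i 0) +
     \sum_j (-1 * ((u w l 0 * u w j 0) * Omega w i j) +
             uhat l 0 * (u w j 0 * Omega w i j)))); last first.
    apply/funext => w; have -> : e w - mu *: (Psi *m (A *m e w)) = H *m e w.
      by rewrite /H mulmxBl mul1mx -scalemxAl mulmxA.
    rewrite dotmxE; apply: eq_bigr => i _.
    rewrite [(H *m _) i 0]mxE mulr_suml; apply: eq_bigr => l _.
    rewrite -mulrA; congr (_ * _); rewrite !mxE -mulrDl mulrBr; congr (_ + _).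
    rewrite mulr_sumr -sumrN; apply: eq_bigr => j _; ring.
  apply: (sum0) => i; apply: (sum0) => l; apply: (scl0); apply: (add0).
    by apply: (add0) => //; exact: scl0.
  by apply: (sum0) => j; apply: (add0); exact: scl0.
have noise : has_mean P (fun w => \sum_i theta w i 0 * theta w i 0 +
      \sum_i \sum_j (u w j 0 * u w j 0) * (Omega w i j * Omega w i j))
   (\sum_i St i + \sum_i \sum_j (mu2 (j, j) * SO i j)).
  apply: has_meanD; first exact: has_mean_sum.
  by apply: has_mean_sum => i; exact: has_mean_sum.
have U0 j : 0 <= mu2 (j, j).
  by apply: (has_mean_le (has_mean_cst P 0) (Hmu2 (j, j))) => w; rewrite -expr2 sqr_ge0.
have muU : \sum_j mu2 (j, j) <= 2 * kQ * v + 2 * dotmx uhat uhat.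
  apply: (has_mean_le (has_mean_sum (fun j => Hmu2 (j, j)))
     (has_meanD (has_meanZ (2 * kQ) ev) (has_mean_cst P (2 * dotmx uhat uhat)))).
  move=> w /=; rewrite -dotmxE -[u w](subrK uhat) -/(e w).
  apply: (le_trans (dotmxx_sqrD _ _)).
  by rewrite lerD2r -mulrA ler_pM2l.
have H1 : v' <= (1 - a * mu + b * mu ^+ 2) * v + c * mu ^+ 2 *
    (\sum_i St i + \sum_i \sum_j (mu2 (j, j) * SO i j)).
  have rhs := has_meanD (has_meanD (has_meanZ (1 - a * mu + b * mu ^+ 2) ev)
    (has_meanZ (2 * mu) cross)) (has_meanZ (c * mu ^+ 2) noise).
  have := has_mean_le ev' rhs; rewrite mulr0 addr0; apply.
  by move=> w; exact: step.
have H2 : \sum_i \sum_j mu2 (j, j) * SO i j <= sO * (2 * kQ * v + 2 * dotmx uhat uhat).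
  apply: (@le_trans _ _ (sO * \sum_j mu2 (j, j))); last by rewrite ler_wpM2l.
  rewrite mulr_suml; apply: ler_sum => i _; rewrite mulr_suml; apply: ler_sum => j _.
  rewrite mulrC; apply: (@le_trans _ _ (`|SO i j| * mu2 (j, j))).
    by rewrite ler_wpM2r// ler_norm.
  by rewrite ler_wpM2l// (bigD1 j)//= lerDl sumr_ge0.
have H3 : \sum_i St i <= \sum_i `|St i| by apply: ler_sum => i _; exact: ler_norm.
apply: (le_trans H1).
have H4 := ler_wpM2l (mulr_ge0 c0 (sqr_ge0 mu)) (lerD H3 H2).
apply: (le_trans (lerD (lexx _) H4)).
by rewrite le_eqVlt; apply/orP; left; apply/eqP; ring.
Qed.

End error_step.

(** * Divergent and convergent series of step sizes *)

Section step_sizes.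
Variables (R : realType) (mu : nat -> R).
Hypothesis mu_gt0 : forall k, (1 <= k)%N -> 0 < mu k.

(** A bound [x] on all sums starting at [K] would bound the whole series by its first [K] terms plus
    [x]. *)
Lemma series_pinfty_sum_gt : (\sum_(1 <= k <oo) (mu k)%:E = +oo)%E ->
  forall (x : R) K, exists n, x < \sum_(K <= j < n) mu j.+1.
Proof.
move=> muoo x K; apply: contrapT => /forallNP H.
have : (\sum_(1 <= k <oo) (mu k)%:E <= (\sum_(0 <= j < K) mu j.+1 + x)%:E)%E.
  apply: lime_le.
    by apply: is_cvg_nneseries => k k1 _; rewrite lee_fin ltW// mu_gt0.
  apply: nearW => n; rewrite sumEFin lee_fin.
  (* For [n <= 1] the partial sum is empty, and [0 <= x] follows from the assumed bound applied to
     an empty sum. *)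
  have [n0|n0] := leqP n 1.
    rewrite big_geq//; have /negP := H 0%N; rewrite -leNgt big_geq// => x0.
    by rewrite addr_ge0// sumr_ge0// => j _; exact/ltW/mu_gt0.
  rewrite -(prednK (ltnW n0)) big_add1/=.
  have /negP := H (maxn n.-1 K); rewrite -leNgt => xge.
  apply: (@le_trans _ _ (\sum_(0 <= j < maxn n.-1 K) mu j.+1)).
    rewrite [leRHS](@big_cat_nat _ _ _ n.-1)//= ?leq_maxl// lerDl.
    by rewrite sumr_ge0// => j _; exact/ltW/mu_gt0.
  by rewrite (@big_cat_nat _ _ _ K)//= ?leq_maxr// lerD2l.
by rewrite muoo leye_eq.
Qed.

(** Some partial sum lies within [eps] of the supremum of all of them, and no later one can exceed
    that supremum. The lemma is later applied to the squares of the step sizes. *)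
Lemma series_lty_tail_lt : (\sum_(1 <= k <oo) (mu k)%:E < +oo)%E ->
  forall eps : R, 0 < eps ->
  exists K, forall n, \sum_(K <= j < n) mu j.+1 < eps.
Proof.
move=> muoo eps eps0.
pose s n := \sum_(0 <= j < n) mu j.+1.
have s_ub n : ((s n)%:E <= \sum_(1 <= k <oo) (mu k)%:E)%E.
  apply: le_trans (nneseries_lim_ge n.+1 _); last first.
    by move=> k k1 _; rewrite lee_fin ltW// mu_gt0.
  by rewrite sumEFin big_add1.
have muoo' : (\sum_(1 <= k <oo) (mu k)%:E)%E \is a fin_num.
  rewrite ge0_fin_numE//; apply: nneseries_ge0 => k k1 _.
  by rewrite lee_fin ltW// mu_gt0.
have sup_s : has_sup (range s).
  split; first by exists (s 0%N), 0%N.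
  exists (fine (\sum_(1 <= k <oo) (mu k)%:E)%E) => _ [n _ <-].
  by rewrite -lee_fin fineK.
have [_ [K _ <-] sK] := sup_adherent eps0 sup_s.
exists K => n; have [nK|/ltnW Kn] := leqP n K; first by rewrite big_geq.
have : s n <= sup (range s) by apply: sup_upper_bound => //; exists n.
rewrite /s (@big_cat_nat _ _ _ K)//= -/(s K); lra.
Qed.

End step_sizes.

(** * From the matrix statement to its scalar entries, and the theorem *)

(** A neighbourhood of a matrix contains a product of entrywise neighbourhoods, and finitely many
    eventual conditions hold together. The generality in [U] covers entries in [\bar R]. *)
Lemma cvg_mx_entries (U : topologicalType) m n (F : nat -> 'M[U]_(m, n))
    (L : 'M[U]_(m, n)) :
  (forall i j, F k i j @[k --> \oo] --> L i j) -> F k @[k --> \oo] --> L.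
Proof.
move=> FL S [V LV VS]; apply: filterS (_ : \forall k \near \oo, forall i j, V i j (F k i j)).
  by move=> k Vk; exact: VS.
by apply: filter_forall => i; apply: filter_forall => j; exact: FL (LV i j).
Qed.

Lemma vecE (R : Type) m n (S : 'M[R]_(m, n)) i j :
  vec S (mxvec_index j i) 0 = S i j.
Proof. by rewrite /vec mxE mxvecE mxE. Qed.

Lemma mean_mx_outerE d (T : measurableType d) (R : realType)
    (P : probability T R) n (V : T -> 'cV[R]_n) i j :
  mean_mx P (fun w => V w *m (V w)^T) i j =
  ('E_P[fun w => (V w i 0 * V w j 0)%R])%E.
Proof.
rewrite mxE; congr ('E_P[_])%E; apply/funext => w.
by rewrite mxE big_ord1 mxE.
Qed.

Lemma spd_preconditioner (R : realType) n (B C : 'M[R]_n) (gamma : R) :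
  spd B -> spsd C -> 0 <= gamma -> spd (B + gamma *: C).
Proof.
move=> [Bsym Bpos] [Csym Cpos] gamma0; split.
  by rewrite /symmetric_mx linearD linearZ/= Bsym Csym.
move=> x x0; rewrite mulmxDr mulmxDl -scalemxAr -scalemxAl mxE [X in _ + X]mxE.
by rewrite ltr_pwDl ?Bpos// mulr_ge0.
Qed.

Theorem theorem2 (R : realType) (d : measure_display) (T : measurableType d)
    (P : probability T R)
    (* the process *)
    (I : set R) (X : R -> {RV P >-> R}) (D : interval R) (rho : R -> R)
    (hX_stat : stationary P I (fun s => X s : T -> R))
    (hX_val : forall s w, I s -> X s w \in D)
    (hX_dens : forall s, I s -> has_density P D rho (X s))
    (* the best approximation problem *)
    (M : nat) (phi : 'I_M -> R -> R) (f : R -> R)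
    (hphi_meas : forall i, measurable_fun [set` D] (phi i))
    (hf_meas : measurable_fun [set` D] f)
    (hphi_free : linearly_independent_on D phi)
    (hA_fin : forall i j,
      density_integrable D rho (fun x => phi i x * phi j x))
    (hb_fin : forall i, density_integrable D rho (fun x => phi i x * f x)) :
  let A := exact_mx D rho phi in
  let b := exact_rhs D rho phi f in
  forall (hA_spd : spd A)
    (uhat : 'cV[R]_M)
    (huhat_min : forall v,
      (square_error D rho phi f uhat <= square_error D rho phi f v)%E)
    (huhat_sol : A *m uhat = b)
    (* the samples *)
    (N : nat) (hN : (0 < N)%N) (t : nat -> nat -> R)
    (ht_dom : forall k n, (1 <= k)%N -> (1 <= n <= N)%N -> I (t k n))
    (ht_block : forall k n, (1 <= k)%N -> (1 <= n <= N)%N ->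
      t k 1%N <= t k n <= t k N)
    (ht_sep : forall k, (1 <= k)%N -> t k N < t k.+1 1%N),
  let Ak := sample_mx (fun s => X s : T -> R) phi N t in
  let bk := sample_rhs (fun s => X s : T -> R) phi f N t in
  let theta k (w : T) : 'cV[R]_M := bk k w - b in
  let Omega k (w : T) : 'M[R]_M := Ak k w - A in
  forall (* the preconditioner *)
    (B C : 'M[R]_M) (hB : spd B) (hC : spsd C)
    (hBA : forall x : 'cV[R]_M, enorm x = 1 ->
      0 < (x^T *m invmx B *m A *m x) 0 0)
    (* the iteration *)
    (u0 : T -> 'cV[R]_M) (hu0 : square_integrable P u0),
  let u gamma mu := iterate (preconditioner B C gamma) Ak bk u0 mu in
  forall
    (htheta_iid : iid P (fun k => theta k.+1))
    (htheta_mean : forall k, (1 <= k)%N -> mean_mx P (theta k) = const_mx 0%E)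
    (hOmega_sym : forall k w, (1 <= k)%N -> symmetric_mx (Omega k w))
    (hOmega_iid : iid P (fun k => Omega k.+1))
    (hOmega_mean : forall k, (1 <= k)%N -> mean_mx P (Omega k) = const_mx 0%E)
    (htheta_L2 : forall k, (1 <= k)%N -> square_integrable P (theta k))
    (hOmega_L2 : forall k, (1 <= k)%N -> square_integrable P (Omega k))
    (hcov_theta : forall k l, (1 <= k)%N -> (1 <= l)%N ->
      mean_mx P (fun w => theta k w *m (theta k w)^T) =
      mean_mx P (fun w => theta l w *m (theta l w)^T))
    (hcov_Omega : forall k l, (1 <= k)%N -> (1 <= l)%N ->
      mean_mx P (fun w => vec (Omega k w) *m (vec (Omega k w))^T) =
      mean_mx P (fun w => vec (Omega l w) *m (vec (Omega l w))^T))
    (hcov_mixed : forall k l, (1 <= k)%N -> (1 <= l)%N ->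
      mean_mx P (fun w => vec (Omega k w) *m (theta k w)^T) =
      mean_mx P (fun w => vec (Omega l w) *m (theta l w)^T))
    (hindep : forall (gamma : R) (mu : nat -> R) (k : nat),
      0 <= gamma -> (forall j, (1 <= j)%N -> 0 < mu j) -> (1 <= k)%N ->
      forall Y Z : T -> R,
        with_products (entries (u gamma mu k.-1)) Y ->
        with_products (entries (theta k) `|` entries (Omega k)) Z ->
        independent2 P Y Z),
  exists gamma0 mu0 : R, 0 < gamma0 /\ 0 < mu0 /\
    forall mu : nat -> R,
      (forall k, (1 <= k)%N -> 0 < mu k <= mu0) ->
      (\sum_(1 <= k <oo) (mu k)%:E = +oo)%E ->
      (\sum_(1 <= k <oo) (mu k ^+ 2)%:E < +oo)%E ->
      forall gamma, 0 <= gamma <= gamma0 ->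
        let e k (w : T) : 'cV[R]_M := u gamma mu k w - uhat in
        mean_mx P (fun w => e k w *m (e k w)^T) @[k --> \oo]
          --> (const_mx 0%E : 'M[\bar R]_M).
Proof.
move=> A b hA_spd uhat _ uhat_sol N _ t _ _ _ Ak bk theta Omega B C hB hC _ u0 hu0 u.
move=> _ theta_mean _ _ Omega_mean theta_L2 Omega_L2 cov_theta cov_Omega _ indep.
(* Any positive bounds would do: the recursion is only used once [mu_k] is small
   enough for the [gamma] at hand, which the summability of [mu_k^2] ensures. *)
exists 1, 1; do 2 split => //.
move=> mu mu01 mu_oo mu2_oo gamma /andP[gamma0 _] e.
have mu_gt0 k : (1 <= k)%N -> 0 < mu k by move=> /mu01/andP[].
set Q := B + gamma *: C.
have Qspd : spd Q by exact: spd_preconditioner.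
have QPsi : Q *m preconditioner B C gamma = 1%:M by rewrite mulmxV// spd_unitmx.
(* The second moments are read off at [k = 1]; since the covariances do not depend on [k], they are
   valid for all steps. *)
have /choice[St HSt] : forall i, exists m,
    has_mean P (fun w => theta 1%N w i 0 * theta 1%N w i 0) m.
  by move=> i; apply/has_mean_Lfun1/Lfun2_mul_Lfun1; exact: theta_L2.
have /choice[SO' HSO] : forall ij : 'I_M * 'I_M, exists m,
    has_mean P (fun w => Omega 1%N w ij.1 ij.2 * Omega 1%N w ij.1 ij.2) m.
  by move=> ij; apply/has_mean_Lfun1/Lfun2_mul_Lfun1; exact: Omega_L2.
pose SO i j := SO' (i, j).
have mt k i : (1 <= k)%N -> has_mean P (fun w => theta k w i 0) 0.
  move=> k1; split; first exact/Lfun2_Lfun1/theta_L2.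
  by have /matrixP/(_ i 0) := theta_mean k k1; rewrite !mxE.
have mO k i j : (1 <= k)%N -> has_mean P (fun w => Omega k w i j) 0.
  move=> k1; split; first exact/Lfun2_Lfun1/Omega_L2.
  by have /matrixP/(_ i j) := Omega_mean k k1; rewrite !mxE.
have st k i : (1 <= k)%N ->
    has_mean P (fun w => theta k w i 0 * theta k w i 0) (St i).
  move=> k1; split; first by apply: Lfun2_mul_Lfun1; exact: theta_L2.
  by rewrite -(HSt i).2 -!mean_mx_outerE (cov_theta k 1%N).
have sO k i j : (1 <= k)%N ->
    has_mean P (fun w => Omega k w i j * Omega k w i j) (SO i j).
  move=> k1; split; first by apply: Lfun2_mul_Lfun1; exact: Omega_L2.
  (* The square of an entry of [Omega] is a diagonal entry of the outer product of [vec (Omega l w)]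
     with itself. *)
  have vecM l : (fun w => Omega l w i j * Omega l w i j) =
      fun w => vec (Omega l w) (mxvec_index j i) 0 * vec (Omega l w) (mxvec_index j i) 0.
    by apply/funext => w; rewrite !vecE.
  rewrite -(HSO (i, j)).2 /= !vecM.
  by rewrite -!(mean_mx_outerE P (fun w => vec (Omega _ w))) (cov_Omega k 1%N).
have [a [c1 [c [a0 c10 c0 step]]]] := mean_error_step P uhat St SO hA_spd Qspd QPsi.
(* Substituting [b = A *m uhat] turns [bk - Ak *m u] into [theta - Omega *m u - A *m (u - uhat)]. *)
have eS k : e k.+1 = fun w => e k w + mu k.+1 *: (preconditioner B C gamma *m
    ((theta k.+1 w - Omega k.+1 w *m u gamma mu k w) - A *m e k w)).
  apply/funext => w; rewrite /e /u /= addrAC; congr (_ + _ *: (_ *m _)).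
  rewrite -/(u gamma mu k w) /theta /Omega mulmxBr mulmxBl uhat_sol.
  move: (bk _ _) (Ak _ _ *m _) (A *m _) => x y z.
  by apply/matrixP => i j; rewrite !mxE; ring.
have stepk k : square_integrable P (e k) -> square_integrable P (e k.+1) /\
    forall v v', has_mean P (fun w => qform Q (e k w)) v ->
      has_mean P (fun w => qform Q (e k.+1 w)) v' ->
      v' <= (1 - a * mu k.+1 + c1 * mu k.+1 ^+ 2) * v + c * mu k.+1 ^+ 2.
  move=> L2e; rewrite eS; apply: step => //.
  - exact/ltW/mu_gt0.
  - rewrite (_ : u gamma mu k = fun w => e k w + uhat).
      by apply: square_integrableD => //; exact: square_integrable_cst.
    by apply/funext => w; rewrite subrK.
  - exact: theta_L2.
  - exact: Omega_L2.
  - by move=> i; exact: mt.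
  - by move=> i j; exact: mO.
  - by move=> i; exact: st.
  - by move=> i j; exact: sO.
  - exact: (indep gamma mu k.+1).
(* Square integrability is carried along the recursion first, so that the means [v k] exist before
   they are compared. *)
have L2e k : square_integrable P (e k).
  elim: k => [|k /stepk[]//].
  by apply: square_integrableD => //; exact: square_integrable_cst.
have /choice[v Hv] : forall k, exists m, has_mean P (fun w => qform Q (e k w)) m.
  by move=> k; apply: has_mean_qform; exact: L2e.
have v0 k : 0 <= v k.
  by apply: (has_mean_le (has_mean_cst P 0) (Hv k)) => w; exact: spd_qform_ge0.
have vS k : v k.+1 <= (1 - a * mu k.+1 + c1 * mu k.+1 ^+ 2) * v k + c * mu k.+1 ^+ 2.
  exact: (stepk k (L2e k)).2.
have vcvg := robbins_monro_cvg a0 c10 c0 v0 (fun k => mu_gt0 k.+1 isT) vS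
   (series_pinfty_sum_gt mu_gt0 mu_oo)
   (series_lty_tail_lt (fun k k1 => exprn_gt0 2 (mu_gt0 k k1)) mu2_oo).
have [kQ kQ0 HQ] := spd_dotmx_le Qspd.
apply: cvg_mx_entries => i j; rewrite mxE.
have /choice[m Hm] : forall k, exists m, has_mean P (fun w => e k w i 0 * e k w j 0) m.
  by move=> k; apply/has_mean_Lfun1/Lfun2_mul_Lfun1; exact: L2e.
rewrite (_ : (fun k => _) = EFin \o m); last first.
  by apply/funext => k; rewrite mean_mx_outerE (Hm k).2.
apply: cvg_EFin; first exact: nearW.
(* Off-diagonal entries are controlled too, since [|e_i e_j|] is at most [dotmx e e], hence at most
   [kQ] times the form of [Q]. *)
have m_le k : `|m k| <= kQ * v k.
  have E w : `|e k w i 0 * e k w j 0| <= kQ * qform Q (e k w).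
    apply: le_trans (HQ _); rewrite ler_norml.
    have := sqr_entry_le (e k w) i; have := sqr_entry_le (e k w) j.
    have := sqr_ge0 (e k w i 0 + e k w j 0); have := sqr_ge0 (e k w i 0 - e k w j 0).
    move: (e k w i 0) (e k w j 0) (dotmx _ _) => x y z h1 h2 h3 h4.
    by apply/andP; split; nra.
  rewrite ler_norml; apply/andP; split.
    rewrite -mulNr; apply: (has_mean_le (has_meanZ (- kQ) (Hv k)) (Hm k)) => w.
    by have := E w; rewrite ler_norml mulNr => /andP[].
  apply: (has_mean_le (Hm k) (has_meanZ kQ (Hv k))) => w.
  by have := E w; rewrite ler_norml => /andP[].
apply/cvgrPdist_le => eps eps0.
have [K HK] := vcvg (eps / kQ) (divr_gt0 eps0 kQ0).
exists K => // k /= Kk; rewrite sub0r normrN (le_trans (m_le k))//.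
by rewrite mulrC -ler_pdivlMr// HK.
Qed.
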